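(* Let $P\subset\mathcal{X}$ be a finite set of points in a metric space $(\mathcal{X},d)$, let $k$ be a positive integer and $\epsilon>0$. Suppose a procedure $\mathrm{AFN}(P,C,\epsilon')$ returning a $(1+\epsilon')$-approximate furthest neighbor in $P$ to a finite set $C$ can be implemented in $T(|C|,\epsilon')$ time. Then the modified greedy algorithm $\mathrm{GREEDY}(P,\epsilon)$ constructs a $(2+\epsilon)$-approximate solution for the $k$-center problem on $P$, i.e. it returns $C\subseteq P$ with $|C|\le k$ and $r$ with $P\subseteq\bigcup_{c\in C}B(c,r)$ and $r\le(2+\epsilon)r^*$, in $O\!\left(k\cdot T\!\left(k,\tfrac{\epsilon}{5}\right)\right)$ time.
   Context: $B(c,r)=\{x:d(x,c)\le r\}$ and $d(q,C)=\min_{c\in C}d(q,c)$. A point $p\in P$ is a $(1+\epsilon')$-approximate furthest neighbor in $P$ to $C$ if $\max_{p'\in P}d(C,p')\le(1+\epsilon')d(C,p)$. The $k$-center problem asks for $C\subseteq P$ with $|C|\le k$ minimizing the radius $r$ with $P\subseteq\bigcup_{c\in C}B(c,r)$; $r^*$ denotes the optimal radius. Algorithm $\mathrm{GREEDY}(P,\epsilon)$: pick an arbitrary $p_1\in P$ and set $C=\{p_1\}$; while $|C|<k$, set $C=C\cup\{\mathrm{AFN}(P,C,\epsilon/5)\}$; then set $r=(1+\epsilon/5)\,d(C,\mathrm{AFN}(P,C,\epsilon/5))$ and return $C$ and $r$.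
   Formalization: The bound r ≤ (2+ε)r* is claimed only for ε ≤ 5/2 (it fails for every larger ε); T is assumed nondecreasing in |C|, each AFN call takes at least one step, and the while loop is cut off after k rounds, which matters only if k > |P|. *)

(* Defs.v *)
From HB Require Import structures.
From mathcomp Require Import all_boot all_order all_algebra finmap.
From mathcomp Require Import all_classical all_reals all_analysis.
Set Implicit Arguments.
Unset Strict Implicit.
Unset Printing Implicit Defensive.
Import Order.TTheory GRing.Theory Num.Theory.
Local Open Scope classical_set_scope.
Local Open Scope fset_scope.
Local Open Scope ring_scope.

Section KCenter.
Context {R : realType} {X : metricType R}.
Implicit Types (P C : {fset X}) (p q c x : X) (e r : R) (k : nat).

(* A minimum when C is nonempty, since C is finite; 0 when C is empty. *)
Definition dist_set q C : R := inf [set mdist q c | c in [set` C]].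

(* The supremum is over a finite set, hence a maximum when P is nonempty. *)
Definition approx_furthest P C e p : Prop :=
  p \in P /\
  sup [set dist_set p' C | p' in [set` P]] <= (1 + e) * dist_set p C.

(* Not the library's closed_ball, which is the closure of the open ball. *)
Definition cball c r : set X := [set x | mdist x c <= r].

Definition kcenter_solution P k C r : Prop :=
  [/\ C `<=` P, (#|` C| <= k)%N &
      ([set` P] `<=` \bigcup_(c in [set` C]) cball c r)%classic].

(* For nonempty P and positive k the infimum is attained: there are finitely
   many candidate sets C, each with a least covering radius. *)
Definition opt_radius P k : R :=
  inf [set r | exists C, kcenter_solution P k C r].

End KCenter.

(* The value computed, paired with the number of elementary steps used. *)
Definition timed (A : Type) : Type := (A * nat)%type.

Definition step {A : Type} (a : A) : timed A := (a, 1%N).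

Definition bind {A B : Type} (m : timed A) (f : A -> timed B) : timed B :=
  ((f m.1).1, (m.2 + (f m.1).2)%N).

Notation "x <- m ;; n" := (bind m (fun x => n))
  (at level 61, m at next level, right associativity).

Section Greedy.
Context {R : realType} {X : metricType R}.
Implicit Types (P C : {fset X}) (p : X) (e : R) (k : nat).

Definition afn_procedure : Type := {fset X} -> {fset X} -> R -> timed X.

(* Any call executes at least one elementary step. *)
Definition implements_AFN P (AFN : afn_procedure) (T : nat -> R -> R) : Prop :=
  forall C e, C != fset0 -> 0 < e ->
    [/\ approx_furthest P C e (AFN P C e).1,
        (0 < (AFN P C e).2)%N &
        (AFN P C e).2%:R <= T #|` C| e].

(* The loop "while |C| < k, add AFN(P, C, e) to C", cut off after n rounds;
   the guard and the insertion cost one step each.  If k <= |P|, every round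
   adds a new point, so n = k is never the reason for stopping; if k > |P|,
   the set C saturates at P and the uncut loop would not terminate. *)
Fixpoint greedy_loop (AFN : afn_procedure) P k e (n : nat) C :
    timed {fset X} :=
  if n is n'.+1 then
    guard <- step (#|` C| < k)%N ;;
    if guard then
      q <- AFN P C e ;;
      C' <- step (q |` C) ;;
      greedy_loop AFN P k e n' C'
    else (C, 0%N)
  else (C, 0%N).

(* Computing d(q, C) costs one step per point of C. *)
Definition greedy (AFN : afn_procedure) P k e (p1 : X) :
    timed ({fset X} * R) :=
  C1 <- step [fset p1] ;;
  C <- greedy_loop AFN P k (e / 5) k C1 ;;
  q <- AFN P C (e / 5) ;;
  D <- (dist_set q C, #|` C|) ;;
  step (C, (1 + e / 5) * D).

End Greedy.
Arguments afn_procedure {R} X.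

(* Main.v *)
(* Let q be the last approximate furthest neighbor, at distance D from the
   returned set C, and e = eps / 5.  The returned radius (1 + e) D covers P.
   If D > 0, each earlier round picked a point at distance at least D / (1 + e)
   from the centers chosen before it, so C and q together form k + 1 points of
   P with pairwise distances at least D / (1 + e).  Two of them share a ball of
   any solution of radius r, whence D <= 2 (1 + e) r. *)
Require Import Defs.
From HB Require Import structures.
From mathcomp Require Import all_boot all_order all_algebra finmap.
From mathcomp Require Import all_classical all_reals all_analysis.
From mathcomp Require Import zify ring lra.
Set Implicit Arguments.
Unset Strict Implicit.
Unset Printing Implicit Defensive.
Import Order.TTheory GRing.Theory Num.Theory.
Local Open Scope ring_scope.

Lemma fset_argmax {T : choiceType} {R : realDomainType}
    (A : {fset T}) (f : T -> R) :
  A != fset0 -> exists2 a, a \in A & forall b, b \in A -> f b <= f a.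
Proof.
move=> /fset0Pn[a0 a0A].
have [i _ imax] :=
  @Order.TotalTheory.arg_maxP _ R A [` a0A]%fset xpredT (fun i => f (val i)) isT.
exists (val i) => [|b bA]; first exact: valP.
exact: (imax [` bA]%fset isT).
Qed.

(** * Distances to finite sets, coverings and separated sets *)

Section Distance.
Context {R : realType} {X : metricType R}.
Implicit Types (P C S : {fset X}) (p q c x y : X) (e r delta : R) (k n : nat).

Lemma dist_set_le q C c : c \in C -> dist_set q C <= mdist q c.
Proof.
move=> cC; apply: ge_inf; last by exists c.
by exists 0 => _ [x _ <-]; exact: mdist_ge0.
Qed.

Lemma dist_set_ge0 q C : 0 <= dist_set q C.
Proof.
have [->|/fset0Pn[c cC]] := eqVneq C fset0.
  (* The infimum of the empty set of reals is 0 by convention. *)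
  suff -> : dist_set q fset0 = 0 by [].
  rewrite /dist_set (_ : [set` fset0] = set0)%classic ?image_set0 ?inf0 //.
  by rewrite -subset0 => x.
apply: lb_le_inf; first by exists (mdist q c), c.
by move=> _ [x _ <-]; exact: mdist_ge0.
Qed.

Lemma dist_set_attained q C :
  C != fset0 -> exists2 c, c \in C & dist_set q C = mdist q c.
Proof.
move=> C0; have [c cC cmin] := fset_argmax (fun c => - mdist q c) C0.
exists c => //; apply/eqP; rewrite eq_le dist_set_le //=.
apply: lb_le_inf; first by exists (mdist q c), c.
by move=> _ [x xC <-]; rewrite -lerN2; exact: cmin.
Qed.

Lemma dist_set_mono q C C' :
  C != fset0 -> (C `<=` C')%fset -> dist_set q C' <= dist_set q C.
Proof.
move=> C0 /fsubsetP CC'; have [c cC ->] := dist_set_attained q C0.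
exact/dist_set_le/CC'.
Qed.

Lemma approx_furthest_ge P C e p q :
  approx_furthest P C e q -> p \in P -> dist_set p C <= (1 + e) * dist_set q C.
Proof.
move=> [_ supq] pP; apply: le_trans supq; apply: ub_le_sup; last by exists p.
have P0 : P != fset0 by apply/fset0Pn; exists p.
(* A [sup] dominates its members only if the set is bounded above; the maximum over [P] supplies the
   bound. *)
have [m _ mP] := fset_argmax (dist_set^~ C) P0.
by exists (dist_set m C) => _ [x xP <-]; exact: mP.
Qed.

Lemma kcenter_solution_ge0 P k C r :
  P != fset0 -> kcenter_solution P k C r -> 0 <= r.
Proof.
move=> /fset0Pn[p pP] [_ _ cov]; have [c _ pc] := cov p pP.
exact: le_trans (mdist_ge0 p c) pc.
Qed.

(** The given solution makes the set of radii nonempty; otherwise [inf] would take its default value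
    0. *)
Lemma le_opt_radius P k C r b : kcenter_solution P k C r ->
  (forall C' r', kcenter_solution P k C' r' -> b <= r') -> b <= opt_radius P k.
Proof.
by move=> sol le_b; apply: lb_le_inf; [exists r, C|move=> r' [C' /le_b]].
Qed.

Definition separated delta S : Prop :=
  forall x y, x \in S -> y \in S -> x != y -> delta <= mdist x y.

Lemma separated_fset1 delta x : separated delta [fset x]%fset.
Proof. by move=> y z /fset1P -> /fset1P ->; rewrite eqxx. Qed.

Lemma separatedU1 delta q C :
  separated delta C -> delta <= dist_set q C -> separated delta (q |` C)%fset.
Proof.
move=> sepC dq x y /fset1UP[->|xC] /fset1UP[->|yC]; last exact: sepC.
- by rewrite eqxx.
- by move=> _; exact: le_trans dq (dist_set_le q yC).
- by move=> _; rewrite metric_sym; exact: le_trans dq (dist_set_le q xC).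
Qed.

Lemma notin_dist_set_gt0 q C : 0 < dist_set q C -> q \notin C.
Proof.
by move=> qC; apply/negP => /(dist_set_le q); rewrite mdistxx leNgt qC.
Qed.

(* By pigeonhole, two points of S lie in a common ball. *)
Lemma separated_le_radius P k C r delta S :
  kcenter_solution P k C r -> (S `<=` P)%fset -> (k < #|` S|)%N ->
  separated delta S -> delta <= 2 * r.
Proof.
move=> [_ Ck cov] /fsubsetP SP kS sepS.
(* Membership in [S] sits under the existential so that [choice] yields a function [center] on all
   of [X]. *)
have {}cov p : exists c, p \in S -> c \in C /\ mdist p c <= r.
  have [pS|pS] := boolP (p \in S); last by exists p.
  by have [c cC pc] := cov p (SP _ pS); exists c.
have [center centerP] := choice cov.
rewrite leNgt; apply/negP => r_lt.
have inj : {in S &, injective center}.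
  move=> x y xS yS xy; apply/eqP; apply: contraT => x_y.
  have [_ dx] := centerP _ xS; have [_] := centerP _ yS.
  rewrite -xy metric_sym => dy.
  have := sepS _ _ xS yS x_y; have := metric_triangle x (center x) y; lra.
have : (#|` [fset center x | x in S]%fset| <= #|` C|)%N.
  apply/fsubset_leq_card/fsubsetP => _ /imfsetP[/= x xS ->].
  by have [] := centerP _ xS.
rewrite card_in_imfset // => SC.
by have := leq_trans kS (leq_trans SC Ck); rewrite ltnn.
Qed.

End Distance.

(** * Invariants and cost of the greedy loop *)

Section Greedy.
Context {R : realType} {X : metricType R} (P : {fset X}) (AFN : afn_procedure X).
Context (T : nat -> R -> R) (AFN_T : implements_AFN P AFN T).
Implicit Types (C : {fset X}) (p q : X) (e delta : R) (k n : nat).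

Lemma greedy_loopS k e n C :
  greedy_loop AFN P k e n.+1 C =
  if (#|` C| < k)%N then
    let afn := AFN P C e in
    let rest := greedy_loop AFN P k e n (afn.1 |` C)%fset in
    (rest.1, (1 + (afn.2 + (1 + rest.2)))%N)
  else (C, 1%N).
Proof. by rewrite /= /bind /=; case: ifP. Qed.

Lemma card_fset1U_le q C : (#|` q |` C|%fset <= #|` C|.+1)%N.
Proof. by rewrite cardfsU1 -add1n leq_add2r leq_b1. Qed.

Lemma afn_in C e : C != fset0 -> 0 < e -> (AFN P C e).1 \in P.
Proof. by move=> C0 e0; have [[]] := AFN_T C0 e0. Qed.

Lemma fset1U_neq0 q C : (q |` C)%fset != fset0.
Proof. by apply/fset0Pn; exists q; exact: fset1U1. Qed.

Lemma greedy_loop_bounds k e n C :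
  C != fset0 -> 0 < e -> (C `<=` P)%fset -> (#|` C| <= k)%N ->
  let C' := (greedy_loop AFN P k e n C).1 in
  [/\ (C `<=` C')%fset, (C' `<=` P)%fset & (#|` C'| <= k)%N].
Proof.
move=> + e0; elim: n C => [|n IH] C C0 CP Ck //.
rewrite greedy_loopS; case: ifP => //= Ck'.
set q := (AFN P C e).1.
have [|||sub ? ?] := IH (q |` C)%fset; first exact: fset1U_neq0.
- by rewrite fsubUset fsub1set CP (afn_in C0 e0).
(* The guard is strict, so there is room for one more center. *)
- exact: leq_trans (card_fset1U_le _ _) Ck'.
by split=> //; apply: fsubset_trans sub; exact: fsubsetU1.
Qed.

(* While some point of P stays at distance at least delta * (1 + e) from the
   final centers, every AFN answer is at distance at least delta from the
   current ones, hence new. *)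
Lemma greedy_loop_separated k e delta n C p :
  C != fset0 -> 0 < e -> (C `<=` P)%fset -> (#|` C| <= k)%N ->
  p \in P -> 0 < delta ->
  let C' := (greedy_loop AFN P k e n C).1 in
  (1 + e) * delta <= dist_set p C' -> separated delta C ->
  separated delta C' /\ (minn k (#|` C| + n) <= #|` C'|)%N.
Proof.
move=> + e0 + + pP d0; elim: n C => [|n IH] C C0 CP Ck /=.
  by move=> _ sepC; split=> //; lia.
have [subC' _ _] := greedy_loop_bounds n.+1 C0 e0 CP Ck.
move: subC'; rewrite -/(greedy_loop AFN P k e n.+1 C) greedy_loopS.
case: ifP => /= Ck'; last by move=> _ _ sepC; split=> //; lia.
set q := (AFN P C e).1 => subC' far sepC.
have [afnq _ _] := AFN_T C0 e0.
(* Adding centers only shrinks distances, so (1 + e) delta <= d(p, C') <= d(p, C) <= (1 + e) d(q,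
   C). *)
have dq : delta <= dist_set q C.
  have e1 : 0 < 1 + e by lra.
  rewrite -(ler_pM2l e1); apply: le_trans far _.
  apply: le_trans (dist_set_mono p C0 subC') _.
  exact: approx_furthest_ge afnq pP.
have qC : q \notin C by apply: notin_dist_set_gt0; exact: lt_le_trans dq.
have [|||||sepC' card] := IH (q |` C)%fset; first exact: fset1U_neq0.
- by rewrite fsubUset fsub1set CP (afn_in C0 e0).
- exact: leq_trans (card_fset1U_le _ _) Ck'.
- exact: far.
- exact: separatedU1.
(* As [q] is new, a round trades one unit of [n] for one center, and the sum in the lower bound is
   unchanged. *)
by split=> //; move: card; rewrite cardfsU1 qC add1n addSnnS.
Qed.

Hypothesis T_mono :
  forall (m n : nat) (e : R), 0 < e -> (m <= n)%N -> T m e <= T n e.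

Lemma afn_time_le k e C :
  C != fset0 -> 0 < e -> (#|` C| <= k)%N -> (AFN P C e).2%:R <= T k e.
Proof.
move=> C0 e0 Ck; have [_ _ tT] := AFN_T C0 e0.
exact: le_trans tT (T_mono e0 Ck).
Qed.

(** A round that inserts costs one call, at most [T k e], plus one step each for guard and
    insertion; a failing guard costs one step and ends the loop. *)
Lemma greedy_loop_time k e n C :
  C != fset0 -> 0 < e -> (C `<=` P)%fset -> (#|` C| <= k)%N -> 1 <= T k e ->
  (greedy_loop AFN P k e n C).2%:R <= n%:R * (T k e + 2).
Proof.
move=> + e0 + + T1; elim: n C => [|n IH] C C0 CP Ck; first by rewrite mul0r.
rewrite greedy_loopS; case: ifP => /= Ck'; last first.
  have : 0 <= n%:R * (T k e + 2) by rewrite mulr_ge0 //; lra.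
  by rewrite -[n.+1%:R]natr1 mulrDl; lra.
have Uk : (#|` (AFN P C e).1 |` C|%fset <= k)%N.
  exact: leq_trans (card_fset1U_le _ _) Ck'.
have UP : ((AFN P C e).1 |` C `<=` P)%fset.
  by rewrite fsubUset fsub1set CP (afn_in C0 e0).
have := IH _ (fset1U_neq0 _ _) UP Uk.
have := afn_time_le C0 e0 Ck.
by rewrite -[n.+1%:R]natr1 !natrD mulrDl; lra.
Qed.

End Greedy.

Theorem theorem5 :
  exists K : nat,
    forall (R : realType) (X : metricType R) (P : {fset X}) (k : nat) (eps : R)
           (AFN : afn_procedure X) (T : nat -> R -> R) (p1 : X),
      (0 < k)%N -> 0 < eps -> p1 \in P ->
      implements_AFN P AFN T ->
      (forall (m n : nat) (e : R), 0 < e -> (m <= n)%N -> T m e <= T n e) ->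
      let out := (greedy AFN P k eps p1).1 in
      let time := (greedy AFN P k eps p1).2 in
      [/\ kcenter_solution P k out.1 out.2,
          eps <= 5 / 2 -> out.2 <= (2 + eps) * opt_radius P k &
          time%:R <= K%:R * (k%:R * T k (eps / 5))].
Proof.
(* With T = [T k e], the loop costs at most k (T + 2), the last call T, the distance k, and the
   first and last steps 2. As k and T are at least 1, the sum k T + 3 k + T + 2 is at most 7 k T. *)
exists 7%N => R X P k eps AFN T p1 k0 eps0 p1P AFN_T T_mono.
rewrite /greedy /bind /=; set e := eps / 5.
have e0 : 0 < e by rewrite /e; lra.
have P0 : P != fset0 by apply/fset0Pn; exists p1.
have C10 : [fset p1]%fset != fset0 by apply/fset0Pn; exists p1; exact: fset11.
have C1P : ([fset p1] `<=` P)%fset by rewrite fsub1set.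
have C1k : (#|` [fset p1]%fset| <= k)%N by rewrite cardfs1.
have [C1C CP Ck] := greedy_loop_bounds AFN_T k C10 e0 C1P C1k.
have T1 : 1 <= T k e.
  have [_ t0 _] := AFN_T _ _ C10 e0.
  by apply: le_trans (afn_time_le AFN_T T_mono C10 e0 C1k); rewrite ler1n.
have loop_time := greedy_loop_time AFN_T T_mono k C10 e0 C1P C1k T1.
(* Kept general in [delta], whose value will depend on the final centers. *)
have loop_sep := fun delta p =>
  @greedy_loop_separated _ _ _ _ _ AFN_T k e delta k _ p C10 e0 C1P C1k.
move: C1C CP Ck loop_time loop_sep.
set C := (greedy_loop _ _ _ _ _ _).1 => C1C CP Ck loop_time loop_sep.
have C0 : C != fset0.
  by apply/fset0Pn; exists p1; apply: (fsubsetP C1C); exact: fset11.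
have [afnq _ _] := AFN_T _ _ C0 e0.
have qtime := afn_time_le AFN_T T_mono C0 e0 Ck.
move: afnq qtime; set q := (AFN P C e).1 => afnq qtime.
have qP : q \in P by case: afnq.
set D := dist_set q C.
have D0 : 0 <= D by exact: dist_set_ge0.
have sol : kcenter_solution P k C ((1 + e) * D).
  split=> // p pP; have [c cC pc] := dist_set_attained p C0.
  by exists c => //; rewrite /cball /= -pc; exact: approx_furthest_ge afnq pP.
split=> //.
- move=> eps_le; have e_le : e <= 1 / 2 by rewrite /e; lra.
  have -> : eps = 5 * e by rewrite /e; field.
  have e51 : 0 < 2 + 5 * e by lra.
  rewrite -ler_pdivrMl //; apply: (le_opt_radius sol) => C' r sol'.
  rewrite ler_pdivrMl //.
  have r0 := kcenter_solution_ge0 P0 sol'.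
  (* If D = 0, [q] may already be a center, but then the bound is trivial. *)
  have [D_gt0|D_le0] := ltP 0 D; last first.
    have -> : D = 0 by apply/eqP; rewrite eq_le D_le0.
    by rewrite mulr0 mulr_ge0 //; lra.
  have e1 : 0 < 1 + e by lra.
  have delta0 : 0 < D / (1 + e) by exact: divr_gt0.
  have eD : (1 + e) * (D / (1 + e)) = D by rewrite mulrC divfK ?gt_eqF.
  (* The last answer [q] itself serves as the far point of [P]. *)
  have [||sepC card] := loop_sep (D / (1 + e)) q qP delta0.
  + by rewrite eD.
  + exact: separated_fset1.
  have qC : q \notin C by exact: notin_dist_set_gt0.
  have sepU : separated (D / (1 + e)) (q |` C)%fset.
    apply: separatedU1 => //; rewrite ler_pdivrMr // ler_peMr //; lra.
  have UP : (q |` C `<=` P)%fset by rewrite fsubUset fsub1set qP.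
  (* Starting from one center with k rounds allowed, the loop reaches min(k, 1 + k) = k centers; [q]
     is one more. *)
  have kU : (k < #|` q |` C|%fset)%N.
    rewrite cardfsU1 qC add1n ltnS; apply: leq_trans card.
    by rewrite cardfs1 leq_min leqnn leq_addl.
  have := separated_le_radius sol' UP kU sepU.
  rewrite ler_pdivrMr // -(ler_pM2l e1) => /le_trans; apply.
  (* 2 (1 + e)^2 <= 2 + 5 e exactly when 2 e <= 1, that is, eps <= 5 / 2. *)
  have -> : (1 + e) * (2 * r * (1 + e)) =
      (2 + 5 * e) * r - e * (1 - 2 * e) * r by ring.
  by rewrite lerBlDr lerDl !mulr_ge0 //; lra.
- have k1 : (1 : R) <= k%:R by rewrite ler1n.
  have Ck' : (#|` C|%:R : R) <= k%:R by rewrite ler_nat.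
  move: loop_time qtime; rewrite !natrD => loop_time qtime.
  have kT : k%:R <= k%:R * T k e by rewrite ler_peMr //; lra.
  have kT' : T k e <= k%:R * T k e by rewrite ler_peMl //; lra.
  lra.
Qed.
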